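(* Let $(G,\cdot)$ be a finite abelian group of order $n$ and let $\{A_0,\dots,A_{m-1}\}$ (with $l,m\ge 2$) be an $(n,m,l;\lambda)$-$1$-SCEDF in $G$. Then $m=2$.
   Context: For subsets $A,B\subseteq G$, $\Delta(A,B)$ is the multiset $\{\{ab^{-1}: a\in A, b\in B\}\}$. For $l,m\ge2$ and $c\in\{1,\dots,m-1\}$, a family $\{A_0,\dots,A_{m-1}\}$ of $m$ pairwise disjoint subsets of $G$ is an $(n,m,l;\lambda)$-$c$-strong circular external difference family (SCEDF) in $G$ if $|A_i|=l$ for all $i$ and, for every $0\le i\le m-1$, $A_{i+c}A_i^{(-1)}=\lambda(G-1_G)$ in the group ring $\mathbb{Z}[G]$ (i.e. each $g\ne 1_G$ occurs exactly $\lambda$ times and $1_G$ does not occur in $\Delta(A_{i+c},A_i)$), with subscripts modulo $m$; here $\lambda$ is a positive integer. *)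

(* Defs.v *)
From mathcomp Require Import all_boot all_fingroup.

Set Implicit Arguments.
Unset Strict Implicit.
Unset Printing Implicit Defensive.

Local Open Scope group_scope.

(* A multiset is represented by a sequence, the multiplicity of g being
   [count_mem g]. *)
Definition Delta (gT : finGroupType) (A B : {set gT}) : seq gT :=
  [seq a * b^-1 | a <- enum A, b <- enum B].

(* (i + c) mod m as an index *)
Definition shift_mod (m c : nat) (i : 'I_m) : 'I_m :=
  Ordinal (ltn_pmod (i + c) (leq_ltn_trans (leq0n i) (ltn_ord i))).

(* The last field is A_(i+c) A_i^(-1) = lambda (G - 1_G) in Z[G], read off
   coefficient by coefficient. *)
Record is_SCEDF (gT : finGroupType) (G : {group gT}) (n m l lambda c : nat)
    (A : 'I_m -> {set gT}) : Prop := IsSCEDF {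
  scedf_order : #|G| = n;
  scedf_l : 2 <= l;
  scedf_m : 2 <= m;
  scedf_c : 0 < c < m;
  scedf_lambda : 0 < lambda;
  scedf_sub : forall i, A i \subset G;
  scedf_disjoint : forall i j, i != j -> [disjoint A i & A j];
  scedf_card : forall i, #|A i| = l;
  scedf_diff : forall (i : 'I_m) (g : gT), g \in G ->
    count_mem g (Delta (A (shift_mod c i)) (A i)) =
      if g == 1 then 0 else lambda
}.

(* Main.v *)
Require Import Defs.
From mathcomp Require Import all_boot all_fingroup.

(** Write A, B, C for three consecutive blocks.  Inverting B A^(-1) =
    lambda (G - 1) gives A B^(-1) = lambda (G - 1) = C B^(-1), so
    (C - A) B^(-1) = 0 in Z[G].  Multiplying by A and using commutativity,
    0 = lambda (C - A) (G - 1) = - lambda (C - A), the last step because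
    |A| = |C|.  Hence A = C, which disjointness forbids as soon as m > 2. *)

Set Implicit Arguments.
Unset Strict Implicit.
Unset Printing Implicit Defensive.

Lemma count_DeltaE (gT : finGroupType) (A B : {set gT}) g :
  count_mem g (Delta A B) = \sum_(a in A) \sum_(b in B) (a * b^-1 == g)%g.
Proof.
rewrite -sum1_count big_mkcond big_allpairs_dep big_enum /=.
apply: eq_bigr => a _; rewrite big_enum /=.
by apply: eq_bigr => b _; case: eqP.
Qed.

Lemma count_Delta_inv (gT : finGroupType) (A B : {set gT}) g :
  count_mem g (Delta A B) = count_mem (g^-1)%g (Delta B A).
Proof.
rewrite !count_DeltaE exchange_big /=; apply: eq_bigr => b _.
by apply: eq_bigr => a _; rewrite -(inj_eq invg_inj) invMg invgK.
Qed.

Lemma sum_indicator (T : finType) (A : {set T}) h :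
  \sum_(a in A) (a == h : nat) = (h \in A).
Proof.
have [hA | nhA] := boolP (h \in A).
  by rewrite (bigD1 h) //= eqxx big1 // => a /andP[_ /negPf->].
by rewrite big1 // => a aA; case: eqP aA nhA => // -> ->.
Qed.

(* The coefficient of h in X B^(-1) A, for X one of A and C, associated in the
   two possible ways. *)
Lemma count_triples_left (gT : finGroupType) (A B X : {set gT}) h :
  \sum_(x in X) \sum_(b in B) \sum_(a in A) (x * b^-1 * a == h)%g =
  \sum_(a in A) count_mem (h * a^-1)%g (Delta X B).
Proof.
under eq_bigr => x _ do rewrite exchange_big /=.
rewrite exchange_big /=; apply: eq_bigr => a _; rewrite count_DeltaE.
apply: eq_bigr => x _; apply: eq_bigr => b _.
by rewrite (can2_eq (mulgK a) (mulgKV a)).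
Qed.

Lemma count_triples_right (gT : finGroupType) (G : {group gT})
    (A B X : {set gT}) h :
  abelian G -> A \subset G -> B \subset G ->
  \sum_(x in X) \sum_(b in B) \sum_(a in A) (x * b^-1 * a == h)%g =
  \sum_(x in X) count_mem (x^-1 * h)%g (Delta A B).
Proof.
move=> abG sAG sBG; apply: eq_bigr => x _.
rewrite count_DeltaE exchange_big /=.
apply: eq_bigr => a aA; apply: eq_bigr => b bB.
(* The only use of commutativity: [x * b^-1 * a] becomes [x * (a * b^-1)], which exposes a
   difference from [Delta A B]. *)
have -> : (a * b^-1 = b^-1 * a)%g.
  by apply: (centsP abG); rewrite ?groupV;
    [exact: (subsetP sAG) | exact: (subsetP sBG)].
by rewrite -mulgA (can2_eq (mulKg x) (mulKVg x)).
Qed.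

Lemma abelian_SCEDF_blocks_eq (gT : finGroupType) (G : {group gT})
    (A B C : {set gT}) lambda :
    abelian G -> A \subset G -> B \subset G -> C \subset G ->
    0 < lambda -> #|A| = #|C| ->
    (forall g, g \in G ->
       count_mem g (Delta B A) = if g == 1%g then 0 else lambda) ->
    (forall g, g \in G ->
       count_mem g (Delta C B) = if g == 1%g then 0 else lambda) ->
  A = C.
Proof.
move=> abG sAG sBG sCG lam_gt0 cardAC dBA dCB.
have dAB g : g \in G ->
    count_mem g (Delta A B) = if g == 1%g then 0 else lambda.
  by move=> Gg; rewrite count_Delta_inv dBA ?groupV // eq_invg1.
(* The coefficient of [h] in [lambda * X * (G - 1)], with the negative term moved to the left so
   that the identity lives in [nat]. *)
have right (X : {set gT}) h : X \subset G -> h \in G ->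
    (\sum_(x in X) \sum_(b in B) \sum_(a in A) (x * b^-1 * a == h)%g)
      + lambda * (h \in X) = lambda * #|X|.
  move=> sXG Gh; rewrite (count_triples_right _ _ abG sAG sBG).
  (* Spreading the indicator over [X] reduces the identity to one [x] at a time: the count is
     [lambda] except at [x = h], where it is 0 and the indicator supplies the missing [lambda]. *)
  rewrite -sum_indicator big_distrr -big_split /= mulnC -sum_nat_const.
  apply: eq_bigr => x xX; have Gx := subsetP sXG x xX.
  rewrite dAB ?groupM ?groupV //.
  by rewrite -eq_mulVg1; case: (x == h); rewrite ?muln1 ?muln0 ?addn0.
apply/setP=> h; have [Gh | nGh] := boolP (h \in G); last first.
  by rewrite !(contraNF (subsetP _ h) nGh).
have := right C h sCG Gh; rewrite -cardAC -(right A h sAG Gh).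
rewrite !count_triples_left.
(* [Delta C B] and [Delta A B] have the same multiplicities on [G], so both triple sums become the
   same expression and cancel, leaving [lambda] times each indicator. *)
under eq_bigr => a aA do rewrite dCB ?groupM ?groupV // ?(subsetP sAG) //.
under [in RHS]eq_bigr => a aA do rewrite dAB ?groupM ?groupV // ?(subsetP sAG) //.
move/addnI/eqP; rewrite eqn_pmul2l //.
by case: (h \in A); case: (h \in C).
Qed.

Theorem theorem6 (gT : finGroupType) (G : {group gT}) (n m l lambda : nat)
    (A : 'I_m -> {set gT}) (hab : abelian G) (hn : #|G| = n)
    (hl : 2 <= l) (hm : 2 <= m) (hA : is_SCEDF G n l lambda 1 A) :
  m = 2.
Proof.
case: hA => _ _ _ _ lam_gt0 sAG disA cardA diffA.
apply/eqP; rewrite eqn_leq hm andbT leqNgt; apply/negP => m_gt2.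
pose i0 : 'I_m := Ordinal (ltnW hm).
pose i1 := shift_mod 1 i0; pose i2 := shift_mod 1 i1.
(* Here [m > 2] is decisive: for [m = 2] the index [i2] wraps around to [i0]. *)
have neq02 : i0 != i2 by rewrite -val_eqE /= !modn_small // modn_small.
have eqA : A i0 = A i2.
  by apply: (abelian_SCEDF_blocks_eq hab _ _ _ lam_gt0 _
               (diffA i0) (diffA i1)); rewrite ?cardA.
(* A block disjoint from itself is empty, against [2 <= l]. *)
move: (disA _ _ neq02); rewrite -eqA -setI_eq0 setIid -cards_eq0 cardA.
by case: (l) hl.
Qed.
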